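(* Consider Plurality Voting (PV) used in every district. (Upper bounds.) For every district-based election with $m$ alternatives, $n$ voters and $k$ districts, every way of breaking ties (in the induced rankings, in the local plurality counts, and in the final weighted count), and every resulting election winner $a$, $$\frac{\max_j\mathrm{SW}(j\mid\mathbf v)}{\mathrm{SW}(a\mid\mathbf v)}\le \begin{cases} 1+\dfrac{3m^2k}{4} & \text{(symmetric)},\\[2mm] 1+\dfrac{m^2}{4}\left(\dfrac{3n+\max_d n_d}{\min_d n_d}-1\right) & \text{(unweighted)},\\[2mm] 1+m^2\left(\dfrac{n}{\min_d n_d}-\dfrac12\right) & \text{(unrestricted)}. \end{cases}$$ (Tightness.) (a) For all integers $m>k\ge2$ and district sizes $n_1,\dots,n_k$ (sum $n$) such that $n_1=\min_\ell n_\ell$ is divisible by $m$, $n_2=\max_\ell n_\ell$, and $n_\ell$ is even for $\ell\ge3$, there is an unweighted election with these district sizes and a tie resolution for which the ratio equals $1+\frac{m^2}{4}\left(\frac{3n+n_2}{n_1}-1\right)$; in particular, when $n_\ell=n/k$ for all $\ell$ with $n/k$ divisible by $m$ (and even if $k\ge3$), the symmetric bound $1+\frac{3m^2k}{4}$ is attained. (b) For all $m\ge2$, $k\ge2$ and district sizes whose minimum is divisible by $m$, there are positive weights, a valuation profile and a tie resolution for which the ratio equals $1+m^2\left(\frac{n}{\min_d n_d}-\frac12\right)$. Thus the distributed distortion of PV is exactly these three values.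
   Context: A district-based election consists of a set $\mathcal M$ of $m$ alternatives, a set $\mathcal N$ of $n$ voters, a partition $\mathcal D$ of $\mathcal N$ into $k$ nonempty districts (district $d$ has $n_d$ voters), positive weights $w_d$, and a valuation profile $\mathbf v$ with $v_{ij}\ge0$, $\sum_j v_{ij}=1$ for all $i$. Each voter's ranking is induced by her valuations ($j$ ranked above $j'$ only if $v_{ij}\ge v_{ij'}$), with ties among equal values broken arbitrarily. Plurality Voting elects, in a given set of voters, an alternative ranked first by the maximum number of voters (ties arbitrary). The local winner $j_d$ of district $d$ is the PV winner among voters of $d$; the election winner is any alternative in $\arg\max_j\sum_d w_d\mathbf 1[j=j_d]$. $\mathrm{SW}(j\mid\mathbf v)=\sum_i v_{ij}$. Symmetric: $n_d=n/k$, $w_d=1$; unweighted: $w_d=1$; unrestricted: arbitrary sizes and positive weights. Distributed distortion: supremum over elections of the class and all tie resolutions of $\max_j\mathrm{SW}(j\mid\mathbf v)/\mathrm{SW}(\text{winner}\mid\mathbf v)$. *)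

(* Defs.v *)
From HB Require Import structures.
From mathcomp Require Import all_boot all_order all_algebra.
Set Implicit Arguments. Unset Strict Implicit. Unset Printing Implicit Defensive.
Import Order.TTheory GRing.Theory Num.Theory.
Local Open Scope ring_scope.

(* Alternatives: 'I_m, voters: 'I_n, districts: 'I_k.
   dist i = district of voter i (the partition D). *)

Definition dsize (n k : nat) (dist : 'I_n -> 'I_k) (d : 'I_k) : nat :=
  #|[set i | dist i == d]|.

(* min_d n_d and max_d n_d (n is an upper bound for all sizes, used as
   neutral element of minn; the districts are nonempty so k >= 1 when n > 0) *)
Definition nmin (n k : nat) (dist : 'I_n -> 'I_k) : nat :=
  \big[minn/n]_(d : 'I_k) dsize dist d.
Definition nmax (n k : nat) (dist : 'I_n -> 'I_k) : nat :=
  \max_(d : 'I_k) dsize dist d.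

Definition nonempty_districts (n k : nat) (dist : 'I_n -> 'I_k) : Prop :=
  forall d, (0 < dsize dist d)%N.

Definition valuation_profile (R : realFieldType) (n m : nat)
  (v : 'I_n -> 'I_m -> R) : Prop :=
  forall i, (forall j, 0 <= v i j) /\ \sum_(j : 'I_m) v i j = 1.

Definition SW (R : realFieldType) (n m : nat) (v : 'I_n -> 'I_m -> R)
  (j : 'I_m) : R := \sum_(i : 'I_n) v i j.

(* j can be ranked first by voter i in a ranking induced by v
   (arbitrary tie-breaking among equally valued alternatives) *)
Definition is_top (R : realFieldType) (n m : nat) (v : 'I_n -> 'I_m -> R)
  (i : 'I_n) (j : 'I_m) : Prop :=
  forall j', v i j' <= v i j.

Definition pv_score (n m k : nat) (dist : 'I_n -> 'I_k) (top : 'I_n -> 'I_m)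
  (d : 'I_k) (j : 'I_m) : nat :=
  #|[set i | (dist i == d) && (top i == j)]|.

Definition weighted_score (R : realFieldType) (m k : nat) (w : 'I_k -> R)
  (loc : 'I_k -> 'I_m) (j : 'I_m) : R :=
  \sum_(d : 'I_k | loc d == j) w d.

(* a is an election winner of district-based PV under some tie resolution:
   top = first choices of induced rankings, loc = local PV winners. *)
Definition PV_outcome (R : realFieldType) (n m k : nat)
  (v : 'I_n -> 'I_m -> R) (dist : 'I_n -> 'I_k) (w : 'I_k -> R)
  (top : 'I_n -> 'I_m) (loc : 'I_k -> 'I_m) (a : 'I_m) : Prop :=
  [/\ forall i, is_top v i (top i),
      forall d j, (pv_score dist top d j <= pv_score dist top d (loc d))%N
    & forall j, weighted_score w loc j <= weighted_score w loc a].

Definition ratio_equals (R : realFieldType) (n m : nat)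
  (v : 'I_n -> 'I_m -> R) (a : 'I_m) (b : R) : Prop :=
  0 < SW v a /\
  exists j, (forall j', SW v j' <= SW v j) /\ SW v j = b * SW v a.

Definition bound_sym (R : realFieldType) (m k : nat) : R :=
  1 + 3%:R * (m%:R ^+ 2) * k%:R / 4%:R.
Definition bound_unw (R : realFieldType) (m n nmx nmn : nat) : R :=
  1 + (m%:R ^+ 2) / 4%:R * ((3%:R * n%:R + nmx%:R) / nmn%:R - 1).
Definition bound_unr (R : realFieldType) (m n nmn : nat) : R :=
  1 + (m%:R ^+ 2) * (n%:R / nmn%:R - 2%:R^-1).

(* Main.v *)
(** Upper bounds.  Fix the winner [a] and another alternative [j].  A voter gives
    [j] at most her value of [a] if she ranks [a] first, at most 1 if she ranks
    [j] first and at most 1/2 otherwise.  In a district won by [a], at least as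
    many voters rank [a] first as [j], so [j] gets there at most the welfare of
    [a] plus half the size of the district.  In a district won by a third
    alternative at most half of the voters rank [j] first, so [j] gets at most
    3/4 of its size; elsewhere it gets at most all of it.  Conversely a district
    of size [s] won by [a] has at least [s/m] voters ranking [a] first, each with
    value at least [1/m], so it gives [a] welfare at least [s/m^2].  With unit
    weights, [j] wins at most as many districts as [a].

    Tightness.  All these estimates are equalities when a voter ranking [a] first
    is indifferent between all alternatives and every other voter splits her
    value between [j] and her first choice.  The election is then determined by
    the numbers of first choices in each district: equal for all alternatives in
    the smallest district, the only one won by [a]. *)

Require Import Defs.
From HB Require Import structures.
From mathcomp Require Import all_boot all_order all_algebra.
From mathcomp Require Import ring lra.
Import Order.TTheory GRing.Theory Num.Theory.
Local Open Scope ring_scope.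
Set Implicit Arguments. Unset Strict Implicit. Unset Printing Implicit Defensive.

(** * Minima with a default value *)

Lemma bigminn_le (I : finType) (b : nat) (F : I -> nat) i :
  (\big[minn/b]_(j : I) F j <= F i)%N.
Proof.
have : i \in index_enum I by rewrite mem_index_enum.
elim: (index_enum I) => // j r IH; rewrite inE big_cons => /orP[/eqP->|/IH h].
  exact: geq_minl.
exact: leq_trans (geq_minr _ _) h.
Qed.

(** If the minimum is its default [b], then [F i0] is squeezed between [b] and [b]. *)
Lemma bigminn_attained (I : finType) (b : nat) (F : I -> nat) (i0 : I) :
  (forall i, F i <= b)%N -> exists i, \big[minn/b]_(j : I) F j = F i.
Proof.
move=> Fb.
have [eqb|//] : \big[minn/b]_(j : I) F j = b \/
    exists i, \big[minn/b]_(j : I) F j = F i.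
  elim/big_ind: _ => [|x y hx hy|i _]; [by left| |by right; exists i].
  by case: (leqP x y).
exists i0; apply/eqP; rewrite eqn_leq bigminn_le.
by rewrite eqb Fb.
Qed.

(** * Counting voters by district and first choice *)

Section DistrictCounts.
Variables (n m k : nat) (dist : 'I_n -> 'I_k) (top : 'I_n -> 'I_m).

Lemma dsize_pv_score d : dsize dist d = (\sum_j pv_score dist top d j)%N.
Proof.
rewrite /dsize -sum1_card (partition_big top xpredT) //=.
apply: eq_bigr => j _; rewrite /pv_score -sum1_card.
by apply: eq_bigl => i; rewrite !inE.
Qed.

Lemma sum_dsize : (\sum_d dsize dist d)%N = n.
Proof.
rewrite -[RHS]card_ord -sum1_card (partition_big dist xpredT) //=.
apply: eq_bigr => d _; rewrite /dsize -sum1_card.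
by apply: eq_bigl => i; rewrite !inE.
Qed.

Lemma nmin_le d : (nmin dist <= dsize dist d)%N.
Proof. exact: bigminn_le. Qed.

Lemma dsize_le_nmax d : (dsize dist d <= nmax dist)%N.
Proof. exact: leq_bigmax. Qed.

Lemma pv_scoreD_le d {j j'} : j != j' ->
  (pv_score dist top d j + pv_score dist top d j' <= dsize dist d)%N.
Proof.
move=> neq; rewrite dsize_pv_score (bigD1 j) //= leq_add2l (bigD1 j') //=.
  exact: leq_addr.
by rewrite eq_sym.
Qed.

(** The [m] scores add up to the size of the district, and none exceeds that of [j]. *)
Lemma dsize_le_mul_winner d j :
  (forall j', (pv_score dist top d j' <= pv_score dist top d j)%N) ->
  (dsize dist d <= m * pv_score dist top d j)%N.
Proof.
move=> jmax; rewrite dsize_pv_score -[m in (m * _)%N]card_ord -sum_nat_const.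
exact: leq_sum.
Qed.

Lemma sum_district_const {R : realFieldType} (x : R) d :
  \sum_(i | dist i == d) x = (dsize dist d)%:R * x.
Proof. by rewrite sumr_const /dsize cardsE mulr_natl. Qed.

Lemma sum_district_top {R : realFieldType} d j :
  \sum_(i | dist i == d) (top i == j)%:R = (pv_score dist top d j)%:R :> R.
Proof.
rewrite /pv_score -sum1_card natr_sum.
rewrite [RHS](eq_bigl (fun i => (dist i == d) && (top i == j))); last first.
  by move=> i; rewrite inE.
by rewrite big_mkcondr; apply: eq_bigr => i _; case: eqP.
Qed.

End DistrictCounts.

Lemma nmin_le_voters n k (dist : 'I_n -> 'I_k) : (nmin dist <= n)%N.
Proof.
rewrite /nmin; elim/big_ind: _ => // [x y xn _|d _].
  exact: leq_trans (geq_minl _ _) xn.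
by rewrite /dsize -[n in (_ <= n)%N]card_ord max_card.
Qed.

Lemma nmin_gt0 {n k} {dist : 'I_n -> 'I_k} :
  nonempty_districts dist -> (0 < n)%N -> (0 < nmin dist)%N.
Proof.
move=> ne n0; rewrite /nmin; elim/big_ind: _ => // x y x0 y0.
by rewrite leq_min x0.
Qed.

(** * Upper bounds on the distortion *)

Section UpperBounds.
Variables (R : realFieldType) (m n k : nat) (dist : 'I_n -> 'I_k).
Variables (w : 'I_k -> R) (v : 'I_n -> 'I_m -> R).
Variables (top : 'I_n -> 'I_m) (loc : 'I_k -> 'I_m) (a : 'I_m).
Hypothesis districts_ne : nonempty_districts dist.
Hypothesis w_gt0 : forall d, 0 < w d.
Hypothesis v_prof : valuation_profile v.
Hypothesis out : PV_outcome v dist w top loc a.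

Local Notation DW d j := (\sum_(i | dist i == d) v i j).
Local Notation sz d := ((dsize dist d)%:R : R).

Lemma val_ge0 i j : 0 <= v i j. Proof. by case: (v_prof i). Qed.

Lemma valD_le1 i {j j'} : j != j' -> v i j + v i j' <= 1.
Proof.
move=> neq; case: (v_prof i) => v0 <-.
rewrite (bigD1 j) //= lerD2l (bigD1 j') /=; last by rewrite eq_sym.
by rewrite lerDl sumr_ge0.
Qed.

Lemma val_le1 i j : v i j <= 1.
Proof.
case: (v_prof i) => v0 <-.
by rewrite (bigD1 j) //= lerDl sumr_ge0.
Qed.

Lemma top_max i j : v i j <= v i (top i).
Proof. by case: out => h _ _; apply: h. Qed.

Lemma loc_max d j :
  (pv_score dist top d j <= pv_score dist top d (loc d))%N.
Proof. by case: out => _ h _; apply: h. Qed.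

(** The largest of [m] values with sum 1 is at least their average. *)
Lemma top_val_ge i : m%:R^-1 <= v i (top i).
Proof.
have m0 : 0 < m%:R :> R by rewrite ltr0n; case: m a => [[]|].
case: (v_prof i) => _ s1.
rewrite -[_^-1]mul1r ler_pdivrMr // mulr_natr -[leLHS]s1.
rewrite -[m in _ *+ m]card_ord -sumr_const.
by apply: ler_sum => j _; apply: top_max.
Qed.

Lemma SW_district j : SW v j = \sum_d DW d j.
Proof. by rewrite /SW (partition_big dist xpredT). Qed.

Lemma district_welfare_le d j : DW d j <= sz d.
Proof.
rewrite -[sz d]mulr1 -sum_district_const.
by apply: ler_sum => i _; apply: val_le1.
Qed.

Lemma district_welfare_ge0 d j : 0 <= DW d j.
Proof. by apply: sumr_ge0 => i _; apply: val_ge0. Qed.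

Lemma val_le_half i j : top i != j -> v i j <= 2^-1.
Proof.
by move=> neq; have := valD_le1 i neq; have := top_max i j; lra.
Qed.

Lemma district_welfare_won d j : j != a -> loc d = a ->
  DW d j <= DW d a + sz d / 2.
Proof.
move=> ja la.
(* The indicators encode three cases: [v i j - v i a] is at most 1, 0 or 1/2 when [i] ranks first
   [j], [a] or a third alternative. *)
have step i : v i j <=
    v i a + (2^-1 + (2^-1 * (top i == j)%:R - 2^-1 * (top i == a)%:R)).
  have [tj|tj] := eqVneq (top i) j.
    by rewrite tj (negbTE ja) /=; have := val_le1 i j; have := val_ge0 i a; lra.
  have := val_le_half tj.
  have [ta|ta] := eqVneq (top i) a; last by have := val_ge0 i a; rewrite /=; lra.
  by have := top_max i j; rewrite ta /=; lra.
apply: (le_trans (ler_sum _ (fun i _ => step i))).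
rewrite !big_split /= sumrN -!mulr_sumr sum_district_const !sum_district_top.
have : ((pv_score dist top d j)%:R <= (pv_score dist top d a)%:R :> R).
  by rewrite ler_nat -la loc_max.
by lra.
Qed.

Lemma district_welfare_other d j : loc d != j ->
  DW d j <= 3 / 4 * sz d.
Proof.
move=> lj.
have step i : v i j <= 2^-1 + 2^-1 * (top i == j)%:R.
  have [tj|tj] := eqVneq (top i) j; first by have := val_le1 i j; rewrite /=; lra.
  by have := val_le_half tj; rewrite /=; lra.
apply: (le_trans (ler_sum _ (fun i _ => step i))).
rewrite big_split /= -mulr_sumr sum_district_const sum_district_top.
(* The supporters of [j] and of the local winner are disjoint, and the former are not more
   numerous. *)
have : (pv_score dist top d j)%:R + (pv_score dist top d j)%:R <= sz d.
  rewrite -natrD ler_nat; apply: leq_trans (pv_scoreD_le dist top d lj).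
  by rewrite leq_add2r loc_max.
by lra.
Qed.

Lemma district_winner_welfare d : loc d = a ->
  sz d <= m%:R ^+ 2 * DW d a.
Proof.
move=> la.
have m0 : 0 < m%:R :> R by rewrite ltr0n; case: m a => [[]|].
have h1 : sz d <= m%:R * (pv_score dist top d a)%:R.
  rewrite -natrM ler_nat -la; apply: dsize_le_mul_winner.
  exact: loc_max.
apply: (le_trans h1); rewrite expr2 -mulrA ler_pM2l //.
rewrite -sum_district_top mulr_sumr; apply: ler_sum => i _.
have [ta|_] := eqVneq (top i) a; last by rewrite mulr_ge0 ?val_ge0 ?ltW.
have := top_val_ge i; rewrite ta -(ler_pM2l m0) mulfV //.
by rewrite gt_eqF.
Qed.

Local Notation NA := (\sum_(d | loc d == a) sz d).

Lemma winner_welfare : NA <= m%:R ^+ 2 * SW v a.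
Proof.
rewrite SW_district mulr_sumr [leLHS]big_mkcond; apply: ler_sum => d _.
case: eqP => [la|_]; first exact: district_winner_welfare.
by rewrite mulr_ge0 ?district_welfare_ge0 ?exprn_ge0.
Qed.

Lemma sum_sz : \sum_d sz d = n%:R.
Proof. by rewrite -natr_sum sum_dsize. Qed.

Lemma SW_le_unrestricted j : SW v j <= SW v a + (n%:R - NA / 2).
Proof.
have NAn : NA <= n%:R.
  by rewrite -sum_sz [leLHS]big_mkcond; apply: ler_sum => d _; case: ifP.
have [->|ja] := eqVneq j a.
  have : 0 <= NA by apply: sumr_ge0.
  by lra.
rewrite !SW_district -sum_sz [NA]big_mkcond mulr_suml -sumrN -!big_split /=.
apply: ler_sum => d _; case: eqP => [la|_].
  by have := district_welfare_won ja la; lra.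
have := district_welfare_le d j; have := district_welfare_ge0 d a; lra.
Qed.

(** The coefficients 3/4, -1/4 and 1/4 combine to 1/2 of the size of a district won by [a], all of
    it if [j] wins and 3/4 otherwise, matching the local estimates. *)
Lemma SW_le_unweighted j : j != a -> SW v j <= SW v a +
  (3 / 4 * n%:R - NA / 4 + (\sum_(d | loc d == j) sz d) / 4).
Proof.
move=> ja.
rewrite !SW_district -sum_sz [NA]big_mkcond [in leRHS](big_mkcond (fun d => loc d == j)).
rewrite !mulr_suml mulr_sumr -sumrN -!big_split /=.
apply: ler_sum => d _; have ga := district_welfare_ge0 d a.
have [la|na] := eqVneq (loc d) a.
  by rewrite la [a == j]eq_sym (negbTE ja); have := district_welfare_won ja la; lra.
have [lj|nj] := eqVneq (loc d) j.
  by have := district_welfare_le d j; lra.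
by have := district_welfare_other nj; lra.
Qed.

(** Otherwise [a] would score 0, less than the local winner of any district. *)
Lemma winner_wins_district : (0 < n)%N -> exists d, loc d = a.
Proof.
move=> n0; have d0 : 'I_k := dist (Ordinal n0).
have [d /eqP|none] := pickP (fun d => loc d == a); first by exists d.
case: out => _ _ /(_ (loc d0)); rewrite /weighted_score [leRHS]big_pred0 //.
rewrite (bigD1 d0) //= => h.
have : 0 <= \sum_(i < k | (loc i == loc d0) && (i != d0)) w i.
  by apply: sumr_ge0 => i _; apply: ltW.
by have := w_gt0 d0; lra.
Qed.

Lemma SW_n0 j : n = 0%N -> SW v j = 0.
Proof. by move=> n0; apply: big1 => i; have := ltn_ord i; rewrite {2}n0. Qed.

(** As [a] wins some district, [NA] is at least the smallest size; this turns the excess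
    [n - NA / 2] into a multiple of [NA], which [winner_welfare] compares with the welfare of
    [a]. *)
Lemma upper_unrestricted j : SW v j <= bound_unr R m n (nmin dist) * SW v a.
Proof.
case: (posnP n) => [n0|n0]; first by rewrite !SW_n0 // mulr0.
have nm0 : 0 < (nmin dist)%:R :> R by rewrite ltr0n; apply: nmin_gt0.
have [d la] := winner_wins_district n0.
have NAm : (nmin dist)%:R <= NA.
  rewrite (bigD1 d) ?la //=; apply: (le_trans (y := sz d)).
    by rewrite ler_nat nmin_le.
  by rewrite lerDl sumr_ge0.
have nn : (nmin dist)%:R <= n%:R :> R by rewrite ler_nat nmin_le_voters.
apply: (le_trans (SW_le_unrestricted j)).
rewrite /bound_unr mulrDl mul1r lerD2l mulrAC.
set q := n%:R / _ - _.
have q0 : 0 <= q.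
  have : 1 <= n%:R / (nmin dist)%:R :> R by rewrite ler_pdivlMr ?mul1r.
  by rewrite /q; lra.
apply: (le_trans (y := NA * q)); last by rewrite ler_wpM2r // winner_welfare.
have : n%:R <= n%:R / (nmin dist)%:R * NA :> R.
  by rewrite mulrAC ler_pdivlMr // ler_wpM2l.
by rewrite /q; lra.
Qed.

Lemma upper_unweighted : (forall d, w d = 1) -> forall j,
  SW v j <= bound_unw R m n (nmax dist) (nmin dist) * SW v a.
Proof.
move=> w1 j.
case: (posnP n) => [n0|n0]; first by rewrite !SW_n0 // mulr0.
have nm0 : 0 < (nmin dist)%:R :> R by rewrite ltr0n; apply: nmin_gt0.
have [d la] := winner_wins_district n0.
have nn : (nmin dist)%:R <= n%:R :> R by rewrite ler_nat nmin_le_voters.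
rewrite /bound_unw mulrDl mul1r.
set q := (3 * n%:R + _) / _ - 1.
have q0 : 0 <= q.
  have : 1 <= (3 * n%:R + (nmax dist)%:R) / (nmin dist)%:R :> R.
    rewrite ler_pdivlMr ?mul1r //.
    have : 0 <= (nmax dist)%:R :> R by []; have := nm0; lra.
  by rewrite /q; lra.
have [->|ja] := eqVneq j a.
  rewrite lerDl !mulr_ge0 ?exprn_ge0 ?invr_ge0 //.
  by apply: sumr_ge0 => i _; apply: val_ge0.
apply: (le_trans (SW_le_unweighted ja)); rewrite lerD2l.
apply: (le_trans (y := NA / 4 * q)); last first.
  rewrite [leRHS](_ : _ = m%:R ^+ 2 * SW v a / 4 * q); last by ring.
  rewrite ler_wpM2r // ler_wpM2r ?invr_ge0 //.
  exact: winner_welfare.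
pose t b : R := \sum_(e | loc e == b) 1.
have tja : t j <= t a.
  have tE b : t b = weighted_score w loc b by apply: eq_bigr => e _; rewrite w1.
  by rewrite !tE; case: out.
have NAm : t a * (nmin dist)%:R <= NA.
  rewrite /t mulr_suml; apply: ler_sum => e _; rewrite mul1r ler_nat.
  exact: nmin_le.
have NBM : \sum_(e | loc e == j) sz e <= t j * (nmax dist)%:R.
  rewrite /t mulr_suml; apply: ler_sum => e _; rewrite mul1r ler_nat.
  exact: dsize_le_nmax.
have t1 : 1 <= t a.
  by rewrite /t (bigD1 d) ?la //= lerDl sumr_ge0.
(* This quotient also bounds 1 and [t j], so it can scale up both [n] and the voters of the
   districts won by [j]. *)
have NA1 : t a <= NA / (nmin dist)%:R by rewrite ler_pdivlMr.
have h1 : n%:R <= n%:R * (NA / (nmin dist)%:R).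
  by rewrite ler_peMr // (le_trans t1).
have h2 : t j * (nmax dist)%:R <= NA / (nmin dist)%:R * (nmax dist)%:R.
  by rewrite ler_wpM2r // (le_trans tja).
rewrite /q [leRHS](_ : _ = 3 / 4 * (n%:R * (NA / (nmin dist)%:R)) +
  (NA / (nmin dist)%:R * (nmax dist)%:R) / 4 - NA / 4); last by field; rewrite gt_eqF.
by lra.
Qed.

(** With all sizes equal, the quotient in the unweighted bound is [3 * k + 1]. *)
Lemma upper_symmetric : (forall d, (k * dsize dist d)%N = n) ->
  (forall d, w d = 1) -> forall j, SW v j <= bound_sym R m k * SW v a.
Proof.
move=> eqsz w1 j.
case: (posnP n) => [n0|n0]; first by rewrite !SW_n0 // mulr0.
have k0 : (0 < k)%N by case: k (dist (Ordinal n0)) => [[]|].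
pose s := (n %/ k)%N.
have szs d : dsize dist d = s.
  by rewrite /s -[X in (X %/ k)%N](eqsz d) mulKn.
have d0 : 'I_k := dist (Ordinal n0).
have nks : n = (k * s)%N by rewrite -(szs d0) eqsz.
have s0 : (0 < s)%N by rewrite -(szs d0).
have maxs : nmax dist = s.
  apply/eqP; rewrite eqn_leq -{2}(szs d0) dsize_le_nmax andbT.
  by apply/bigmax_leqP => d _; rewrite szs.
have mins : nmin dist = s.
  apply/eqP; rewrite eqn_leq -{1}(szs d0) nmin_le /=.
  (* The default value [n] of the minimum is [k * s], hence at least [s]. *)
  rewrite /nmin; elim/big_ind: _ => [|x y|d _]; first by rewrite [leqRHS]nks leq_pmull.
    by rewrite leq_min => -> ->.
  by rewrite szs.
have := upper_unweighted w1 j; rewrite maxs mins.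
rewrite (_ : bound_unw R m n s s = bound_sym R m k) //.
rewrite /bound_unw /bound_sym [in n%:R]nks natrM; field.
by rewrite pnatr_eq0 -lt0n.
Qed.

End UpperBounds.

(** * Extremal elections with prescribed first choices *)

(** List each pair of a district and an alternative as often as [c] prescribes; the entry at
    position [i] describes voter [i]. *)
Lemma electorate_of_counts n m k (c : 'I_k -> 'I_m -> nat) :
  n = (\sum_d \sum_x c d x)%N ->
  exists (dist : 'I_n -> 'I_k) (top : 'I_n -> 'I_m),
    forall d x, pv_score dist top d x = c d x.
Proof.
pose s := flatten [seq nseq (c p.1 p.2) p | p : 'I_k * 'I_m].
move=> nE; have szs : size s == n.
  rewrite size_flatten /shape -map_comp sumnE big_map big_enum nE pair_bigA /=.
  by apply/eqP; apply: eq_bigr => p _; rewrite size_nseq.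
pose t := Tuple szs.
exists (fun i => (tnth t i).1), (fun i => (tnth t i).2) => d x.
rewrite /pv_score -sum1_card.
rewrite (eq_bigl (fun i => tnth t i == (d, x))); last by move=> i; rewrite inE.
rewrite -(big_tuple _ _ t (fun p => p == (d, x)) (fun=> 1%N)) sum1_count.
rewrite count_flatten sumnE !big_map /= (bigD1 (d, x)) //=.
rewrite count_nseq /= eqxx mul1n big1 ?addn0 // => p /negbTE np.
by rewrite count_nseq /= np.
Qed.

(* The value of [x] for a voter ranking [t] first, where [a] is the winner and
   [j] the optimal alternative: the profile makes [a] as cheap, and [j] as
   valuable, as the first choices permit. *)
Definition extremal_val (R : realFieldType) m (a j t x : 'I_m) : R :=
  if t == a then m%:R^-1 else ((x == j)%:R + (x == t)%:R) / 2.

Lemma sum_ord_eq (R : realFieldType) m (j : 'I_m) :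
  \sum_x (x == j)%:R = 1 :> R.
Proof.
by rewrite (bigD1 j) //= eqxx big1 ?addr0 // => x /negbTE->.
Qed.

Section ExtremalElection.
Variables (R : realFieldType) (m n : nat) (a j : 'I_m) (top : 'I_n -> 'I_m).
Hypothesis neq_aj : a != j.

Let v i := extremal_val R a j (top i).

Let m_gt0 : 0 < m%:R :> R.
Proof. by rewrite ltr0n; case: m a => [[]|]. Qed.

Lemma extremal_profile : valuation_profile v.
Proof.
move=> i; rewrite /v /extremal_val; case: eqP => _; (split; first move=> x).
- by rewrite invr_ge0 ltW.
- by rewrite sumr_const card_ord -[LHS]mulr_natr mulVf // gt_eqF.
- by rewrite divr_ge0 ?addr_ge0.
- by rewrite -mulr_suml big_split /= !sum_ord_eq; lra.
Qed.

Lemma extremal_is_top i : is_top v i (top i).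
Proof.
move=> x; rewrite /v /extremal_val; case: (top i == a) => //.
rewrite eqxx ler_pM2r ?invr_gt0 // [top i == j]eq_sym.
have [->|xj] := eqVneq x j; first by case: (j == top i); rewrite /=; lra.
by case: (x == top i); case: (j == top i); rewrite /=; lra.
Qed.

(** This holds voter by voter: one not ranking [a] first gives [j] at least 1/2 and any other
    alternative at most 1/2. *)
Lemma extremal_SW_max x : SW v x <= SW v j.
Proof.
apply: ler_sum => i _; rewrite /v /extremal_val; case: (top i == a) => //.
rewrite eqxx ler_pM2r ?invr_gt0 //.
have [->|xj] := eqVneq x j; first by [].
by rewrite add0r (le_trans (y := 1)) ?lerDl // lern1 leq_b1.
Qed.

Lemma extremal_SW_winner : SW v a = m%:R^-1 * \sum_i (top i == a)%:R.
Proof.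
rewrite /SW mulr_sumr; apply: eq_bigr => i _; rewrite /v /extremal_val.
rewrite (negbTE neq_aj) [a == top i]eq_sym.
by case: (top i == a); rewrite ?mulr1 // addr0 mul0r mulr0.
Qed.

(** The coefficients encode the value of [j]: 1/m for a voter ranking [a] first, 1 for one ranking
    [j] first, 1/2 for any other. *)
Lemma extremal_SW_optimal : SW v j = 2^-1 * n%:R +
  (m%:R^-1 - 2^-1) * \sum_i (top i == a)%:R + 2^-1 * \sum_i (top i == j)%:R.
Proof.
have -> : n%:R = \sum_(i < n) 1 :> R by rewrite sumr_const card_ord.
rewrite /SW !mulr_sumr -!big_split /=; apply: eq_bigr => i _.
rewrite /v /extremal_val eqxx [j == top i]eq_sym.
have [->|_] := eqVneq (top i) a; first by rewrite (negbTE neq_aj) /=; lra.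
by case: (top i == j); rewrite /=; lra.
Qed.

End ExtremalElection.

(** Reduces tightness to arithmetic on counts: the last hypothesis is the welfare ratio of [j] to
    [a], with denominators cleared. *)
Lemma extremal_election (R : realFieldType) m n k (c : 'I_k -> 'I_m -> nat)
    (sz : 'I_k -> nat) (w : 'I_k -> R) (loc : 'I_k -> 'I_m) (a j : 'I_m) (b : R) :
  a != j ->
  n = (\sum_d sz d)%N ->
  (forall d, \sum_x c d x = sz d)%N ->
  (forall d x, c d x <= c d (loc d))%N ->
  (forall x, weighted_score w loc x <= weighted_score w loc a) ->
  (0 < \sum_d c d a)%N ->
  2^-1 * n%:R + (m%:R^-1 - 2^-1) * (\sum_d c d a)%:R
    + 2^-1 * (\sum_d c d j)%:R = b * (m%:R^-1 * (\sum_d c d a)%:R) ->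
  exists (dist : 'I_n -> 'I_k) (v : 'I_n -> 'I_m -> R) (top : 'I_n -> 'I_m),
    [/\ forall d, dsize dist d = sz d, valuation_profile v,
        PV_outcome v dist w top loc a & ratio_equals v a b].
Proof.
move=> neq nE szE locmax wmax A0 bE.
have [|dist [top pvE]] := @electorate_of_counts n m k c.
  by rewrite nE; apply: eq_bigr => d _.
have topE x : \sum_i (top i == x)%:R = (\sum_d c d x)%:R :> R.
  rewrite (partition_big dist xpredT) //= natr_sum; apply: eq_bigr => d _.
  by rewrite sum_district_top pvE.
exists dist, (fun i => extremal_val R a j (top i)), top; split.
- by move=> d; rewrite (dsize_pv_score dist top) -szE; apply: eq_bigr.
- exact: extremal_profile.
- split; [by move=> i; apply: extremal_is_top | | exact: wmax].
  by move=> d x; rewrite !pvE.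
- split.
    rewrite extremal_SW_winner // topE mulr_gt0 ?ltr0n // invr_gt0 ltr0n.
    by case: m a {c loc wmax A0 bE topE top pvE locmax szE neq j} => [[]|].
  exists j; split; first by move=> x; apply: extremal_SW_max.
  by rewrite extremal_SW_winner // extremal_SW_optimal // !topE.
Qed.

(** * Tight elections *)

Lemma sum_ord_eqn m l : (l < m)%N -> (\sum_(x < m) (x == l :> nat) = 1)%N.
Proof.
move=> lm; rewrite (bigD1 (Ordinal lm)) //= eqxx big1 // => x.
by rewrite -val_eqE /= => /negbTE->.
Qed.

(* The number of voters of district [d] ranking [x] first, in an election with
   winner 0 and optimal alternative 1. Every district elects its own index, so
   the final count is a tie among all of them. *)
Definition unweighted_counts (m : nat) (sz : nat -> nat) (d x : nat) : nat :=
  match d with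
  | 0 => sz 0 %/ m
  | 1 => (x == 1) * sz 1
  | _ => ((x == 1) + (x == d)) * (sz d)./2
  end%N.

Lemma tight_unweighted (R : realFieldType) (m k n : nat) (sz : nat -> nat) :
  (2 <= k)%N -> (k < m)%N -> (0 < sz 0)%N -> (m %| sz 0)%N ->
  (forall l, (2 <= l)%N -> (l < k)%N -> ~~ odd (sz l)) ->
  n = (\sum_(l < k) sz l)%N ->
  exists (dist : 'I_n -> 'I_k) (v : 'I_n -> 'I_m -> R)
         (top : 'I_n -> 'I_m) (loc : 'I_k -> 'I_m) (a : 'I_m),
    [/\ forall d : 'I_k, dsize dist d = sz d, valuation_profile v,
        PV_outcome v dist (fun _ => 1) top loc a
      & ratio_equals v a (bound_unw R m n (sz 1%N) (sz 0%N))].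
Proof.
case: k => [|[|k]] // _ km sz0 dvd ev nE.
have m0 : (0 < m)%N by apply: leq_trans km.
have m1 : (1 < m)%N by apply: leq_trans km.
pose a := Ordinal m0; pose j := Ordinal m1.
(* As [k < m], each district can elect a different alternative, so no weighted score exceeds 1. *)
pose loc := widen_ord (ltnW km).
pose c (d : 'I_k.+2) (x : 'I_m) := unweighted_counts m sz d x.
have s0E : sz 0 = (sz 0 %/ m * m)%N by rewrite divnK.
have szE d : (\sum_x c d x = sz d)%N.
  rewrite /c; case: d => [[|[|d]]] dk /=.
  - by rewrite sum_nat_const card_ord mulnC -s0E.
  - by rewrite -big_distrl /= sum_ord_eqn ?mul1n.
  - rewrite -big_distrl /= big_split /= !sum_ord_eqn //; last first.
      exact: ltn_trans dk km.
    by rewrite add1n mul2n even_halfK // ev.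
have AE : (\sum_d c d a = sz 0 %/ m)%N.
  by rewrite big_ord_recl big1 ?addn0 // => [[[|d] dk]] _.
(* Districts from index 2 on split evenly between [j] and their own winner: [H] of their [2 * H]
   voters rank [j] first. *)
pose H := (\sum_(i < k) (sz i.+2)./2)%N.
have JE : (\sum_d c d j = sz 0 %/ m + (sz 1 + H))%N.
  rewrite 2!big_ord_recl /c /= mul1n; congr (_ + (_ + _))%N.
  by apply: eq_bigr => i _; rewrite /= mul1n.
have nH : n = (sz 0 + (sz 1 + H.*2))%N.
  rewrite nE 2!big_ord_recl /= /H -mul2n big_distrr /=; congr (_ + (_ + _))%N.
  by apply: eq_bigr => i _; rewrite mul2n even_halfK // ev //= ltnS ltnS.
have [||||dist [v [top h]]] := @extremal_election R m n k.+2 c sz (fun=> 1) loc a j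
    (bound_unw R m n (sz 1%N) (sz 0%N)) isT nE szE; last by exists dist, v, top, loc, a.
- move=> d x; rewrite /c; case: d => [[|[|d]]] dk //=.
    by rewrite leq_mul2r leq_b1 orbT.
  (* The district index is at least 2, so [x] cannot equal both it and 1. *)
  by rewrite leq_mul2r eqxx; case: (x : nat) => [|[|y]]; rewrite //= ?leq_b1 orbT.
- move=> x.
  have locI : injective loc by move=> d e /(congr1 val) /= /val_inj.
  apply: (le_trans (y := 1)).
    rewrite /weighted_score; case: (pickP (fun d => loc d == x)) => [d /eqP <-|none].
      by rewrite (big_pred1 d) // => e; rewrite (inj_eq locI).
    by rewrite big_pred0.
  rewrite /weighted_score (big_pred1 ord0) // => d.
- by rewrite AE divn_gt0 // dvdn_leq.
- rewrite AE JE /bound_unw [in n%:R]nH s0E.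
  set q := (sz 0 %/ m)%N; rewrite mulnK //.
  have q0 : q%:R != 0 :> R by rewrite pnatr_eq0 -lt0n divn_gt0 // dvdn_leq.
  have mr0 : m%:R != 0 :> R by rewrite pnatr_eq0 -lt0n.
  by rewrite -mul2n !(natrD, natrM); field; rewrite q0 mr0.
Qed.

Lemma tight_symmetric (R : realFieldType) (m k n s : nat) :
  (2 <= k)%N -> (k < m)%N -> (0 < s)%N -> (m %| s)%N ->
  ((3 <= k)%N -> ~~ odd s) -> n = (k * s)%N ->
  exists (dist : 'I_n -> 'I_k) (v : 'I_n -> 'I_m -> R)
         (top : 'I_n -> 'I_m) (loc : 'I_k -> 'I_m) (a : 'I_m),
    [/\ forall d : 'I_k, dsize dist d = s, valuation_profile v,
        PV_outcome v dist (fun _ => 1) top loc a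
      & ratio_equals v a (bound_sym R m k)].
Proof.
move=> k2 km s0 dvd ev nE.
have -> : bound_sym R m k = bound_unw R m n s s.
  rewrite /bound_unw /bound_sym nE natrM; field.
  by rewrite pnatr_eq0 -lt0n.
apply: (@tight_unweighted R m k n (fun=> s)) => //.
  (* A district of index at least 2 exists only if [k] is at least 3. *)
  by move=> l l2 lk; apply: ev; apply: leq_trans lk.
by rewrite sum_nat_const card_ord.
Qed.

(** Let [a] win only a smallest district, by a tie among all alternatives, and let all other voters
    rank [j] first. *)
Lemma tight_unrestricted (R : realFieldType) (m k n : nat) (sz : 'I_k -> nat) :
  (2 <= m)%N -> (2 <= k)%N -> (forall d, (0 < sz d)%N) ->
  (m %| \big[minn/n]_(d : 'I_k) sz d)%N -> n = (\sum_(d : 'I_k) sz d)%N ->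
  exists (dist : 'I_n -> 'I_k) (w : 'I_k -> R) (v : 'I_n -> 'I_m -> R)
         (top : 'I_n -> 'I_m) (loc : 'I_k -> 'I_m) (a : 'I_m),
    [/\ forall d, dsize dist d = sz d, forall d, 0 < w d, valuation_profile v,
        PV_outcome v dist w top loc a
      & ratio_equals v a (bound_unr R m n (\big[minn/n]_(d : 'I_k) sz d))].
Proof.
move=> m1 k2 szpos dvd nE.
have m0 : (0 < m)%N by apply: leq_trans m1.
have k0 : (0 < k)%N by apply: leq_trans k2.
have [|d0 minE] := @bigminn_attained _ n sz (Ordinal k0).
  by move=> d; rewrite nE (bigD1 d) //= leq_addr.
rewrite minE in dvd *.
pose a := Ordinal m0; pose j := Ordinal m1.
pose loc (d : 'I_k) := if d == d0 then a else j.
(* Weight [k] outweighs the other [k - 1] districts, all won by [j], together. *)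
pose w (d : 'I_k) : R := if d == d0 then k%:R else 1.
pose c (d : 'I_k) (x : 'I_m) :=
  (if d == d0 then sz d0 %/ m else (x == j) * sz d)%N.
have s0E : sz d0 = (sz d0 %/ m * m)%N by rewrite divnK.
have szE d : (\sum_x c d x = sz d)%N.
  rewrite /c; case: eqP => [->|_].
    by rewrite sum_nat_const card_ord mulnC -s0E.
  by rewrite -big_distrl /= (@sum_ord_eqn m 1) ?mul1n.
have AE : (\sum_d c d a = sz d0 %/ m)%N.
  by rewrite (bigD1 d0) //= big1 /c ?eqxx ?addn0 // => d /negbTE->.
pose N := (\sum_(d | d != d0) sz d)%N.
have JE : (\sum_d c d j = sz d0 %/ m + N)%N.
  rewrite (bigD1 d0) //= /c eqxx; congr (_ + _)%N.
  by apply: eq_bigr => d /negbTE ->; rewrite mul1n.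
have nN : n = (sz d0 + N)%N by rewrite nE (bigD1 d0).
have [||||dist [v [top [h1 h2 h3 h4]]]] := @extremal_election R m n k c sz w loc a j
    (bound_unr R m n (sz d0)) isT nE szE; last first.
- exists dist, w, v, top, loc, a; split=> // d.
  by rewrite /w; case: ifP => // _; rewrite ltr0n.
- rewrite AE JE /bound_unr [in n%:R]nN s0E.
  set q := (sz d0 %/ m)%N; rewrite mulnK //.
  have q0 : q%:R != 0 :> R by rewrite pnatr_eq0 -lt0n divn_gt0 // dvdn_leq.
  have mr0 : m%:R != 0 :> R by rewrite pnatr_eq0 -lt0n.
  by rewrite !(natrD, natrM); field; rewrite q0 mr0.
- by rewrite AE divn_gt0 // dvdn_leq.
- have wa : weighted_score w loc a = k%:R.
    rewrite /weighted_score (big_pred1 d0) /w ?eqxx // => d.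
    by rewrite /loc /=; case: (d == d0).
  move=> x; have [->//|xa] := eqVneq x a.
  rewrite wa -[k in leRHS]card_ord -sumr_const /weighted_score big_mkcond.
  apply: ler_sum => d _; rewrite /loc /w.
  by case: (d == d0); [rewrite eq_sym (negbTE xa) | case: ifP].
- move=> d x; rewrite /c /loc; case: (d == d0) => //.
  by rewrite leq_mul2r leq_b1 orbT.
Qed.

Theorem theorem3 :
  (* Upper bounds *)
  (forall (R : realFieldType) (m n k : nat) (dist : 'I_n -> 'I_k)
          (w : 'I_k -> R) (v : 'I_n -> 'I_m -> R)
          (top : 'I_n -> 'I_m) (loc : 'I_k -> 'I_m) (a : 'I_m),
     nonempty_districts dist ->
     (forall d, 0 < w d) ->
     valuation_profile v ->
     PV_outcome v dist w top loc a ->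
     [/\ (* symmetric *)
         ((forall d, (k * dsize dist d)%N = n) -> (forall d, w d = 1) ->
            forall j, SW v j <= bound_sym R m k * SW v a),
         (* unweighted *)
         ((forall d, w d = 1) ->
            forall j, SW v j <= bound_unw R m n (nmax dist) (nmin dist) * SW v a)
       & (* unrestricted *)
         (forall j, SW v j <= bound_unr R m n (nmin dist) * SW v a)]) /\
  (* Tightness (a), unweighted; district l (0-indexed) has size sz l,
     district 0 is a smallest one, district 1 a largest one *)
  (forall (R : realFieldType) (m k n : nat) (sz : nat -> nat),
     (2 <= k)%N -> (k < m)%N ->
     (forall l, (l < k)%N -> (0 < sz l)%N) ->
     (forall l, (l < k)%N -> (sz 0 <= sz l)%N) ->
     (forall l, (l < k)%N -> (sz l <= sz 1)%N) ->
     (m %| sz 0)%N ->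
     (forall l, (2 <= l)%N -> (l < k)%N -> ~~ odd (sz l)) ->
     n = (\sum_(l < k) sz l)%N ->
     exists (dist : 'I_n -> 'I_k) (v : 'I_n -> 'I_m -> R)
            (top : 'I_n -> 'I_m) (loc : 'I_k -> 'I_m) (a : 'I_m),
       [/\ forall d : 'I_k, dsize dist d = sz d,
           valuation_profile v,
           PV_outcome v dist (fun _ => 1) top loc a
         & ratio_equals v a (bound_unw R m n (sz 1%N) (sz 0%N))]) /\
  (* Tightness (a), symmetric special case *)
  (forall (R : realFieldType) (m k n s : nat),
     (2 <= k)%N -> (k < m)%N -> (0 < s)%N -> (m %| s)%N ->
     ((3 <= k)%N -> ~~ odd s) ->
     n = (k * s)%N ->
     exists (dist : 'I_n -> 'I_k) (v : 'I_n -> 'I_m -> R)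
            (top : 'I_n -> 'I_m) (loc : 'I_k -> 'I_m) (a : 'I_m),
       [/\ forall d : 'I_k, dsize dist d = s,
           valuation_profile v,
           PV_outcome v dist (fun _ => 1) top loc a
         & ratio_equals v a (bound_sym R m k)]) /\
  (* Tightness (b), unrestricted *)
  (forall (R : realFieldType) (m k n : nat) (sz : 'I_k -> nat),
     (2 <= m)%N -> (2 <= k)%N ->
     (forall d, (0 < sz d)%N) ->
     (m %| \big[minn/n]_(d : 'I_k) sz d)%N ->
     n = (\sum_(d : 'I_k) sz d)%N ->
     exists (dist : 'I_n -> 'I_k) (w : 'I_k -> R) (v : 'I_n -> 'I_m -> R)
            (top : 'I_n -> 'I_m) (loc : 'I_k -> 'I_m) (a : 'I_m),
       [/\ forall d, dsize dist d = sz d,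
           forall d, 0 < w d,
           valuation_profile v,
           PV_outcome v dist w top loc a
         & ratio_equals v a (bound_unr R m n (\big[minn/n]_(d : 'I_k) sz d))]).
Proof.
split; last split; last split.
- move=> R m n k dist w v top loc a ne w0 vp out; split.
  + exact: upper_symmetric ne w0 vp out.
  + exact: upper_unweighted ne w0 vp out.
  + exact: upper_unrestricted ne w0 vp out.
- move=> R m k n sz k2 km szpos _ _ dvd ev nE.
  by apply: tight_unweighted => //; apply: szpos; apply: leq_trans k2.
- exact: tight_symmetric.
- exact: tight_unrestricted.
Qed.
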